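(* Let $G$ be a $P_4$-free graph without isolated vertices. If $D$ is a minimum dominating set of $G$ such that $pri(v,D)\cap (V(G)\setminus D)\neq\emptyset$ for all $v\in D$, then $D$ is also a $[1,2]$-set of $G$.
   Context: All graphs are finite, simple and undirected. $N(v)$ is the neighborhood and $N[v]=N(v)\cup\{v\}$ the closed neighborhood of $v$; for $S\subseteq V(G)$, $N[S]=\bigcup_{v\in S}N[v]$. A graph is $P_4$-free if it has no induced subgraph isomorphic to the path $P_4$ on four vertices. A dominating set is a set $D$ with $N[D]=V(G)$; a minimum dominating set is one of minimum cardinality. For $v\in D$, $pri(v,D)=N[v]\setminus N[D\setminus\{v\}]$. A set $S\subseteq V(G)$ is a $[1,2]$-set of $G$ if $1\leq |N(v)\cap S|\leq 2$ for every vertex $v\in V(G)\setminus S$. *)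

(* Defs.v *)
From mathcomp Require Import all_boot.

Set Implicit Arguments.
Unset Strict Implicit.
Unset Printing Implicit Defensive.

(* A finite simple graph is a finType T of vertices with a symmetric and
   irreflexive adjacency relation e : rel T; symmetry and irreflexivity are
   hypotheses of the theorem, not part of the definitions below. *)

Definition nbhd (T : finType) (e : rel T) (v : T) : {set T} :=
  [set w | e v w].

Definition cnbhd (T : finType) (e : rel T) (v : T) : {set T} :=
  v |: nbhd e v.

Definition cnbhd_set (T : finType) (e : rel T) (S : {set T}) : {set T} :=
  \bigcup_(v in S) cnbhd e v.

(* f is an isomorphism from the graph (U, h) onto the subgraph of (T, e)
   induced by the image of f. *)
Definition has_induced (T : finType) (e : rel T) (U : finType) (h : rel U) :
  Prop :=
  exists2 f : U -> T, injective f & forall x y : U, e (f x) (f y) = h x y.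

Definition path_rel (n : nat) : rel 'I_n :=
  fun i j => (i.+1 == j :> nat) || (j.+1 == i :> nat).

Definition P4_free (T : finType) (e : rel T) : Prop :=
  ~ has_induced e (@path_rel 4).

Definition no_isolated (T : finType) (e : rel T) : Prop :=
  forall v : T, nbhd e v != set0.

Definition dominating (T : finType) (e : rel T) (D : {set T}) : Prop :=
  cnbhd_set e D = [set: T].

Definition minimum_dominating (T : finType) (e : rel T) (D : {set T}) : Prop :=
  dominating e D /\
  forall D' : {set T}, dominating e D' -> #|D| <= #|D'|.

Definition pri (T : finType) (e : rel T) (v : T) (D : {set T}) : {set T} :=
  cnbhd e v :\: cnbhd_set e (D :\ v).

Definition one_two_set (T : finType) (e : rel T) (S : {set T}) : Prop :=
  forall v : T, v \notin S -> 1 <= #|nbhd e v :&: S| <= 2.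

(* Main.v *)
Require Import Defs.
From mathcomp Require Import all_boot.

(** If [x] is a neighbour of [v] with the most neighbours outside [N[v]], then in
    a [P_4]-free graph [{v, x}] dominates everything within distance two of [v].
    Hence if [v] had three neighbours in [D], exchanging all of [N(v) :&: D] for
    [v] and [x] would give a smaller dominating set. *)

(** The three edges and three non-edges already force the four vertices to be distinct. *)
Lemma P4_free_no_path (T : finType) (e : rel T) (a b c d : T) :
    symmetric e -> irreflexive e -> P4_free e ->
    e a b -> e b c -> e c d -> ~~ e a c -> ~~ e a d -> ~~ e b d -> False.
Proof.
move=> e_sym e_irr P4f ab bc cd /negbTE ac /negbTE ad /negbTE bd.
pose f (i : 'I_4) := nth a [:: a; b; c; d] i.
have fE (i j : 'I_4) : e (f i) (f j) = path_rel i j.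
  (* Irreflexivity settles the diagonal; [e_sym] flips the pairs listed in the wrong order. *)
  case: i => [[|[|[|[|i]]]] lti] //; case: j => [[|[|[|[|j]]]] ltj] //;
  by rewrite /f /path_rel /= ?e_irr ?ab ?bc ?cd ?ac ?ad ?bd // e_sym
             ?ab ?bc ?cd ?ac ?ad ?bd.
apply: P4f; exists f => // i j fij.
(* Distinct vertices of P_4 have distinct neighbourhoods. *)
have nbhdE k : path_rel i k = path_rel j k by rewrite -!fE fij.
apply/val_inj; move: (nbhdE (inord 0)) (nbhdE (inord 1)) (nbhdE (inord 2)) (nbhdE (inord 3)).
rewrite /path_rel !inordK //; clear.
by case: i => [[|[|[|[|i]]]] lti] //; case: j => [[|[|[|[|j]]]] ltj].
Qed.

Lemma cnbhd_setP (T : finType) (e : rel T) (S : {set T}) (w : T) :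
  reflect (exists2 u, u \in S & (w == u) || e u w) (w \in cnbhd_set e S).
Proof.
by apply: (iffP bigcupP) => -[u uS uw]; exists u => //; move: uw; rewrite !inE.
Qed.

(** If [x] misses some [z] in [far w], then maximality of [#|far x|] yields a [y] in [far x] outside
    [far w], and four of [v], [x], [w], [y], [z] induce a path. *)
Lemma P4_free_dominating_edge (T : finType) (e : rel T) (v u : T) :
    symmetric e -> irreflexive e -> P4_free e -> e v u ->
  exists x, forall w z, e v w -> e w z -> [|| z == v, e v z | e x z].
Proof.
move=> e_sym e_irr P4f vu.
pose far x := nbhd e x :\: cnbhd e v.
case: (@arg_maxnP _ u (e v) (fun x => #|far x|) vu) => x vx xmax.
exists x => w z vw wz; apply/negPn/negP; rewrite !negb_or => /and3P[zv vz xz].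
have zw : z \in far w by rewrite !inE negb_or zv vz.
have zx : z \notin far x by rewrite !inE (negbTE xz) andbF.
have [sub|/subsetPn[y]] := boolP (far x \subset far w).
  have /proper_card : far x \proper far w by apply/properP; split=> //; exists z.
  by move=> lt; have := leq_trans lt (xmax w vw); rewrite ltnn.
rewrite !inE negb_or => /andP[/andP[yv vy] xy]; rewrite yv vy /= => wy.
have path4 := P4_free_no_path _ _ _ _ _ _ e_sym e_irr P4f.
(* Outside [N[v]], [y] sees [x] but not [w], and [z] sees [w] but not [x]; only the pairs [x], [w]
   and [y], [z] are undecided. *)
have [xw|xw] := boolP (e x w); last by apply: (path4 y x v w); rewrite // e_sym.
have [yz|yz] := boolP (e y z); first by apply: (path4 v x y z).
by apply: (path4 y x w z); rewrite // e_sym.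
Qed.

Theorem theorem4p4 (T : finType) (e : rel T)
    (e_sym : symmetric e) (e_irr : irreflexive e)
    (P4f : P4_free e) (noiso : no_isolated e)
    (D : {set T}) (Dmin : minimum_dominating e D)
    (Dpri : forall v : T, v \in D -> pri e v D :&: ~: D != set0) :
  one_two_set e D.
Proof.
move=> v vD; case: Dmin => domD minD.
have domP w : exists2 u, u \in D & (w == u) || e u w.
  by apply/cnbhd_setP; rewrite domD inE.
have [u uD vu] : exists2 u, u \in D & e v u.
  have [u uD /orP[/eqP vu|uv]] := domP v; first by rewrite vu uD in vD.
  by exists u; rewrite // e_sym.
apply/andP; split; first by apply/card_gt0P; exists u; rewrite !inE vu.
have [x xdom] := P4_free_dominating_edge _ _ _ _ e_sym e_irr P4f vu.
pose D' := [set v; x] :|: D :\: nbhd e v.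
have /minD leD : dominating e D'.
  apply/setP => z; rewrite in_setT; apply/cnbhd_setP.
  (* A dominator [w] of [z] not adjacent to [v] survives in [D']; otherwise [z] is within distance
     two of [v]. *)
  have [w wD wz] := domP z; have [vw|vw] := boolP (e v w); last first.
    by exists w; rewrite // !inE vw wD !orbT.
  have : [|| z == v, e v z | e x z].
    by case/orP: wz => [/eqP->|/(xdom _ _ vw)//]; rewrite vw orbT.
  rewrite orbA => /orP[vz|xz]; first by exists v; rewrite // !inE eqxx.
  by exists x; rewrite ?xz ?orbT // !inE eqxx orbT.
(* Adding [#|D :\: nbhd e v|] to both sides turns the left one into [#|D|] and the right one into a
   bound on [#|D'|]. *)
rewrite -(leq_add2r #|D :\: nbhd e v|) setIC cardsID (leq_trans leD) //.
rewrite (leq_trans (leq_card_setU _ _)) // leq_add2r cards2.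
by case: (v != x).
Qed.
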